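(* For every partition $\lambda$, with respect to the order $<_2$, \[ \sum_{\sigma\ \Phi\text{-degenerate}}(-1)^{m(\sigma)}q^{p(\sigma)+\mathrm{maj}(\sigma)}t^{\mathrm{quinv}(\sigma)}x^{|\sigma|}=0, \] the sum being over all $\Phi$-degenerate super fillings of $\mathrm{dg}(\lambda)$.
   Context: Let $\lambda=(\lambda_1\ge\dots\ge\lambda_k>0)$ be a partition; $\mathrm{dg}(\lambda)=\{(r,i):1\le i\le k,1\le r\le\lambda_i\}$, $(r,i)$ being row $r$ from the bottom and column $i$ from the left (columns bottom-justified of heights $\lambda_i$); $\mathrm{leg}((r,i))=\lambda_i-r$. $\mathcal A=\{1,\bar1,2,\bar2,\dots\}$ consists of positive letters $i$ and negative letters $\bar i$, $|i|=|\bar i|=i$, totally ordered by $<_2$: $0<1<2<3<\cdots<\bar3<\bar2<\bar1$. $I(a,b)=1$ if $a>b$ or $a=b$ is negative, and $I(a,b)=0$ if $a<b$ or $a=b$ is positive. A super filling is $\sigma:\mathrm{dg}(\lambda)\to\mathcal A$; a cell $u=(r,i)$, $r>1$, is a descent if $I(\sigma(u),\sigma((r-1,i)))=1$, and $\mathrm{maj}(\sigma)=\sum_{\text{descents }u}(\mathrm{leg}(u)+1)$. A triple is either three cells $(r+1,i),(r,i),(r,j)$ with $i<j$, or (degenerate) two cells $(r,i),(r,j)$ with $i<j$ and $\lambda_i=r$; with $a=\sigma((r+1,i))$ ($a=0$ if degenerate), $b=\sigma((r,i))$, $c=\sigma((r,j))$, it is a quinv triple iff exactly one of $I(a,b)=1$,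 $I(c,b)=0$, $I(a,c)=0$ holds; $\mathrm{quinv}(\sigma)$ is their number. $x^{|\sigma|}=\prod_u x_{|\sigma(u)|}$; $p(\sigma),m(\sigma)$ are the numbers of positive, resp. negative, entries. The reading order goes through rows top to bottom, each row right to left. The distinguished label of $\sigma$ is the smallest positive integer $a$ such that some cell $(r,j)$ has $|\sigma((r,j))|=a$ and $r>a$; the distinguished cell is the first cell in reading order whose entry has absolute value $a$; $\sigma$ is $\Phi$-degenerate if $a$ exists and the distinguished cell belongs to some degenerate triple. *)

(* Defs.v *)
From mathcomp Require Import all_boot all_order all_algebra.
Set Implicit Arguments. Unset Strict Implicit. Unset Printing Implicit Defensive.
Import GRing.Theory.

(* A letter of the super alphabet: (|a|, a is negative).
   Positive letter i = (i,false), negative letter \bar i = (i,true), i >= 1.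
   The auxiliary value 0 (used for degenerate triples) is (0,false). *)
Definition letter := (nat * bool)%type.
Definition zero_letter : letter := (0, false).
Definition absl (a : letter) : nat := a.1.
Definition is_neg (a : letter) : bool := a.2.

(* The order <_2 : 0 < 1 < 2 < ... < \bar 3 < \bar 2 < \bar 1 *)
Definition lt2 (a b : letter) : bool :=
  if a.2 then b.2 && (b.1 < a.1) else b.2 || (a.1 < b.1).

Definition Iind (a b : letter) : bool := lt2 b a || ((a == b) && is_neg a).

Definition is_partition (lam : seq nat) : Prop :=
  sorted geq lam /\ all (fun n => 0 < n) lam.

(* lambda_i, 1-indexed *)
Definition lamc (lam : seq nat) (i : nat) : nat := nth 0 lam i.-1.

(* cells are (r, i): row r from the bottom, column i from the left *)
Definition cell := (nat * nat)%type.
Definition in_dg (lam : seq nat) (c : cell) : bool :=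
  [&& 1 <= c.2, c.2 <= size lam, 1 <= c.1 & c.1 <= lamc lam c.2].

Definition cells (lam : seq nat) : seq cell :=
  [seq (r, i) | i <- iota 1 (size lam), r <- iota 1 (lamc lam i)].

Definition leg (lam : seq nat) (c : cell) : nat := lamc lam c.2 - c.1.

Definition filling := nat -> nat -> letter.

Definition entry (s : filling) (c : cell) : letter := s c.1 c.2.

Definition maj (lam : seq nat) (s : filling) : nat :=
  \sum_(u <- cells lam | (1 < u.1) && Iind (entry s u) (s u.1.-1 u.2))
     (leg lam u + 1).

Definition quinv_trip (a b c : letter) : bool :=
  (Iind a b : nat) + (~~ Iind c b : nat) + (~~ Iind a c : nat) == 1.

Definition quinv_nondeg (lam : seq nat) (s : filling) : nat :=
  \sum_(u <- cells lam) \sum_(v <- cells lam)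
    [&& u.1 == v.1, u.2 < v.2, in_dg lam (u.1.+1, u.2)
      & quinv_trip (s u.1.+1 u.2) (entry s u) (entry s v)].

Definition deg_triple (lam : seq nat) (u v : cell) : bool :=
  [&& u.1 == v.1, u.2 < v.2 & lamc lam u.2 == u.1].

Definition quinv_deg (lam : seq nat) (s : filling) : nat :=
  \sum_(u <- cells lam) \sum_(v <- cells lam)
    (deg_triple lam u v && quinv_trip zero_letter (entry s u) (entry s v)).

Definition quinv (lam : seq nat) (s : filling) : nat :=
  quinv_nondeg lam s + quinv_deg lam s.

Definition npos (lam : seq nat) (s : filling) : nat :=
  count (fun u => ~~ is_neg (entry s u)) (cells lam).
Definition nneg (lam : seq nat) (s : filling) : nat :=
  count (fun u => is_neg (entry s u)) (cells lam).

Definition reading (lam : seq nat) : seq cell :=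
  [seq u <- [seq (r, i) | r <- rev (iota 1 (head 0 lam)),
                          i <- rev (iota 1 (size lam))] | in_dg lam u].

Definition dlabel (lam : seq nat) (s : filling) : option nat :=
  match [seq absl (entry s u) | u <- cells lam &
           (0 < absl (entry s u)) && (absl (entry s u) < u.1)] with
  | [::] => None
  | x :: l => Some (foldr minn x l)
  end.

Definition dcell (lam : seq nat) (s : filling) (a : nat) : option cell :=
  ohead [seq u <- reading lam | absl (entry s u) == a].

Definition in_deg_triple (lam : seq nat) (w : cell) : bool :=
  has (fun u => has (fun v => deg_triple lam u v && ((w == u) || (w == v)))
                    (cells lam)) (cells lam).

Definition phi_degenerate (lam : seq nat) (s : filling) : bool :=
  if dlabel lam s is Some a then
    if dcell lam s a is Some w then in_deg_triple lam w else false
  else false.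

Local Open Scope ring_scope.
Definition weight (R : comNzRingType) (lam : seq nat) (q t : R) (x : nat -> R)
    (s : filling) : R :=
  (-1) ^+ nneg lam s * q ^+ (npos lam s + maj lam s) * t ^+ quinv lam s
  * \prod_(u <- cells lam) x (absl (entry s u)).
Local Close Scope ring_scope.

(* super fillings with entries of absolute value <= N, encoded as tuples
   indexed by (the list) cells lam; (j, b) : 'I_N * bool is the letter of
   absolute value j+1, negative iff b. *)
Definition fill (lam : seq nat) (N : nat)
    (e : (size (cells lam)).-tuple ('I_N * bool)) : filling :=
  fun r i => nth zero_letter [seq ((val p.1).+1, p.2) | p <- e]
                 (index (r, i) (cells lam)).

(* Main.v *)
Require Import Defs.
From mathcomp Require Import all_boot all_order all_algebra.
From mathcomp Require Import zify ring.
From Stdlib Require Import FunctionalExtensionality.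
Set Implicit Arguments. Unset Strict Implicit. Unset Printing Implicit Defensive.
Import GRing.Theory.

(** Fix the distinguished label [a] and the row [r] of the distinguished cell.
    That cell lies in a degenerate triple iff it tops one of the columns of
    height exactly [r] and there are at least two such columns.  Record the
    top row of this block as a word in [a], [bar a] and [y] (any other letter).

    Two operations act on the fillings with fixed [a] and [r].  Adjacent columns
    of height [r] can be exchanged from the top row down to a suitable row so
    that maj, and quinv outside the top row, do not change.  The sign of an
    entry of absolute value [a] can be flipped: as [a] and [bar a] are the
    extreme letters among those of absolute value at least [a], this preserves
    p + maj, and quinv except for the degenerate triples inside the block.
    Hence, up to the factor (-1)^neg t^coinv determined by the word, the sum
    over the fillings with a given word depends only on its length and on the
    number m > 0 of its letters of absolute value [a].  The sum of
    (-1)^neg t^coinv over these words is a t-binomial coefficient times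
    the product of the 1 - t^k for k < m, which vanishes because of k = 0. *)

(** * Sequences and iterated operators *)

Lemma mem_foldr_minn x l : foldr minn x l \in x :: l.
Proof.
elim: l => [|z l IH] /=; first by rewrite mem_head.
rewrite /minn; case: ifP => _; move: IH; rewrite !inE ?eqxx ?orbT //.
by case/orP=> ->; rewrite ?orbT.
Qed.

Lemma foldr_minn_leq x l y : y \in x :: l -> foldr minn x l <= y.
Proof.
elim: l => [|z l IH] /=; first by rewrite inE => /eqP ->.
by rewrite geq_min !inE orbCA => /orP[/eqP->|/IH ->]; rewrite ?leqnn ?orbT.
Qed.

Lemma perm_eq_invariant (T : eqType) (U : Type) (A : seq T -> U) :
  (forall u x y v, A (u ++ x :: y :: v) = A (u ++ y :: x :: v)) ->
  forall p p', perm_eq p p' -> A p = A p'.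
Proof.
move=> swapA p p' pp'.
suffices prefixA u s s' : perm_eq s s' -> A (u ++ s) = A (u ++ s') by apply: (prefixA [::]).
have frontA l : forall u' x v, A (u' ++ l ++ x :: v) = A (u' ++ x :: l ++ v).
  elim: l => //= y l IH u' x v.
  by rewrite -cat_rcons IH cat_rcons swapA.
elim: s u s' => [|x s IH] u s'; first by rewrite perm_sym => /perm_nilP ->.
move=> ss'; have x_in : x \in s' by rewrite -(perm_mem ss') mem_head.
case/splitPr: x_in ss' => l v ss'; rewrite frontA -!(cat_rcons x); apply: IH.
by rewrite -(perm_cons x) (perm_trans ss') // -[x :: v]cat1s perm_catCA.
Qed.

Lemma eq_sum_but_one (I : eqType) (l : seq I) (i0 : I) (F G : I -> nat) (x y : nat) :
  uniq l -> i0 \in l -> F i0 + x = G i0 + y ->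
  (forall i, i \in l -> i != i0 -> F i = G i) ->
  \sum_(i <- l) F i + x = \sum_(i <- l) G i + y.
Proof.
move=> l_uniq i0_in eq_i0 eq_off; rewrite !(bigD1_seq i0) //= addnAC eq_i0 addnAC.
congr (_ + _ + _); rewrite big_seq_cond [RHS]big_seq_cond.
by apply: eq_bigr => i /andP[]; apply: eq_off.
Qed.

Lemma sum_nat_pick (m n r : nat) (F : nat -> nat) : m <= r < n ->
  \sum_(m <= k < n) (k == r) * F k = F r.
Proof.
move=> lt_r; under eq_bigr do rewrite mulnbl.
by rewrite -big_mkcond big_nat1_eq lt_r.
Qed.

Lemma big_tuple_cons (R : Type) (idx : R) (op : Monoid.com_law idx) (T : finType) (n : nat)
    (P : pred (seq T)) (F : seq T -> R) :
  \big[op/idx]_(p : n.+1.-tuple T | P p) F p =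
  \big[op/idx]_(x : T) \big[op/idx]_(w : n.-tuple T | P (x :: w)) F (x :: w).
Proof.
rewrite pair_big_dep (reindex (fun xw : T * n.-tuple T => cons_tuple xw.1 xw.2)) //=.
exists (fun p : n.+1.-tuple T => (thead p, behead_tuple p)) => [[x w] _|p _] /=.
  by congr (_, _); apply: val_inj.
by apply: val_inj; rewrite [in RHS](tuple_eta p).
Qed.

Lemma big_option_bool (R : Type) (idx : R) (op : Monoid.com_law idx) (F : option bool -> R) :
  \big[op/idx]_(x : option bool) F x = op (F None) (op (F (Some true)) (F (Some false))).
Proof.
rewrite (bigD1 None) // (bigD1 (Some true)) // (big_pred1 (Some false)) //.
by case=> [[]|].
Qed.

Lemma sum_fibers_eq0 (V : nmodType) (I : finType) (K : eqType) (key : I -> K)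
    (P : pred I) (F : I -> V) :
  (forall k, (\sum_(i | P i && (key i == k)) F i = 0)%R) -> (\sum_(i | P i) F i = 0)%R.
Proof.
move=> fiber_eq0.
transitivity (\sum_(k <- undup (codom key)) \sum_(i | P i && (key i == k)) F i)%R; last first.
  by rewrite big1.
rewrite (exchange_big_dep P) /= => [|k i _ /andP[] //]; apply: eq_bigr => i Pi.
rewrite Pi -big_filter (eq_filter (a2 := pred1 (key i))); last by move=> k; rewrite /= eq_sym.
by rewrite filter_pred1_uniq ?undup_uniq ?mem_undup ?codom_f // big_seq1.
Qed.

(** * Quinv triples *)

Lemma Iind0 c : Iind zero_letter c = false.
Proof. by case: c => [n []]; rewrite /Iind /lt2 /zero_letter /= ?andbF. Qed.

Lemma IindC b c : b != c -> Iind b c = ~~ Iind c b.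
Proof.
case: b c => [b []] [c []]; rewrite /Iind /lt2 /is_neg /= !xpair_eqE /=;
  rewrite ?andbT ?andbF ?orbF //; by case: ltngtP.
Qed.

Lemma Iind_posl a c : a <= absl c -> Iind (a, false) c = false.
Proof. by case: c => n []; rewrite /Iind /lt2 /absl /is_neg /= ?andbF ?orbF //=; lia. Qed.

Lemma Iind_negl a c : a <= absl c -> Iind (a, true) c.
Proof. by case: c => n []; rewrite /Iind /lt2 /absl /is_neg //= xpair_eqE andbT; lia. Qed.

Lemma Iind_posr a c : a < absl c -> Iind c (a, false).
Proof. by case: c => n []; rewrite /Iind /lt2 /absl /is_neg //= => ->. Qed.

Lemma Iind_negr a c : a < absl c -> Iind c (a, true) = false.
Proof. by case: c => n []; rewrite /Iind /lt2 /absl /is_neg //= xpair_eqE ?andbT; lia. Qed.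

(* Of the three conditions defining a quinv triple one or two always hold, so
   the indicator is linear in the values of [Iind]. *)
Lemma quinv_tripE a b c : quinv_trip a b c + Iind a b = Iind c b + Iind a c :> nat.
Proof.
case: a b c => [a []] [b []] [c []]; rewrite /quinv_trip /Iind /lt2 /is_neg /=;
  rewrite !xpair_eqE /= ?andbT ?andbF ?orbF;
  by case: (ltngtP a b); case: (ltngtP a c); case: (ltngtP b c) => //=; lia.
Qed.

Lemma quinv_trip0 b c : quinv_trip zero_letter b c = Iind c b.
Proof. by have := quinv_tripE zero_letter b c; rewrite !Iind0 !addn0; lia. Qed.

Lemma quinv_trip_signl a b c : a <= absl b -> a <= absl c ->
  quinv_trip (a, true) b c = quinv_trip (a, false) b c.
Proof.
move=> le_ab le_ac; have := quinv_tripE (a, true) b c; have := quinv_tripE (a, false) b c.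
by rewrite !Iind_posl // !Iind_negl //; lia.
Qed.

Lemma quinv_trip_signr a x b : a < absl x -> a <= absl b ->
  quinv_trip x b (a, true) = quinv_trip x b (a, false).
Proof.
move=> lt_ax le_ab; have := quinv_tripE x b (a, true); have := quinv_tripE x b (a, false).
by rewrite Iind_posl // Iind_negl // Iind_posr // Iind_negr //; lia.
Qed.

Lemma Iind_exchange x y b c : quinv_trip x b c = quinv_trip y b c ->
  Iind y b + Iind x c = Iind x b + Iind y c :> nat.
Proof. by have := quinv_tripE x b c; have := quinv_tripE y b c; lia. Qed.

Lemma quinv_trip_exchange x y b c d : quinv_trip x b c = quinv_trip y b c ->
  quinv_trip y b d + quinv_trip x c d = quinv_trip x b d + quinv_trip y c d :> nat.
Proof.
move=> /Iind_exchange; have := quinv_tripE x b d; have := quinv_tripE y b d.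
have := quinv_tripE x c d; have := quinv_tripE y c d.
do !move: (nat_of_bool _) => ?; lia.
Qed.

Lemma quinv_trip_swap x y b c : quinv_trip x b c != quinv_trip y b c ->
  quinv_trip y c b = quinv_trip x b c.
Proof.
have := quinv_tripE x b c; have := quinv_tripE y b c; have := quinv_tripE y c b.
have [->|/IindC ->] := eqVneq b c; lia.
Qed.

Lemma quinv_trip_neqC x y b c :
  (quinv_trip x b c != quinv_trip y b c) = (quinv_trip x c b != quinv_trip y c b).
Proof.
have := quinv_tripE x b c; have := quinv_tripE x c b.
have := quinv_tripE y b c; have := quinv_tripE y c b; lia.
Qed.

(** * Adjacent transpositions and sums over pairs *)

Definition transp (j i : nat) : nat := if i == j then j.+1 else if i == j.+1 then j else i.

Lemma transpL j : transp j j = j.+1.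
Proof. by rewrite /transp eqxx. Qed.

Lemma transpR j : transp j j.+1 = j.
Proof. by rewrite /transp eqxx gtn_eqF. Qed.

Lemma transpD j i : i != j -> i != j.+1 -> transp j i = i.
Proof. by rewrite /transp => /negbTE-> /negbTE->. Qed.

Lemma transpK j : involutive (transp j).
Proof. by move=> i; rewrite /transp; do !case: eqP => //=; lia. Qed.

Lemma perm_map_transp j m n : m <= j -> j.+1 < n ->
  perm_eq (map (transp j) (index_iota m n)) (index_iota m n).
Proof.
move=> le_mj lt_jn; have transpI := inv_inj (transpK j).
apply: uniq_perm; rewrite ?(map_inj_uniq transpI) ?iota_uniq // => i.
by rewrite -[in LHS](transpK j i) mem_map // !mem_index_iota /transp; do !case: eqP; lia.
Qed.

Lemma nth_transp (T : Type) (x0 : T) u y z v k :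
  nth x0 (u ++ y :: z :: v) (transp (size u) k) = nth x0 (u ++ z :: y :: v) k.
Proof.
have [->|ne_u] := eqVneq k (size u).
  by rewrite transpL !nth_cat ltnn subnn ltnNge leqnSn subSnn.
have [->|ne_uS] := eqVneq k (size u).+1.
  by rewrite transpR !nth_cat ltnn subnn ltnNge leqnSn subSnn.
rewrite transpD // !nth_cat; case: ltnP => // le_u.
by rewrite (_ : k - size u = (k - (size u).+2).+2) //; lia.
Qed.

Lemma eq_big_nat_adjacent (R : Type) (idx : R) (op : Monoid.law idx) (m j n : nat)
    (F G : nat -> R) :
  m <= j -> j.+1 < n -> op (F j) (F j.+1) = op (G j) (G j.+1) ->
  (forall i, m <= i < n -> i != j -> i != j.+1 -> F i = G i) ->
  \big[op/idx]_(m <= i < n) F i = \big[op/idx]_(m <= i < n) G i.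
Proof.
move=> le_mj lt_jn eq_j eq_off.
rewrite !(big_cat_nat (n := j) (m := m) (p := n)) ?(ltnW (ltnW lt_jn)) //=.
rewrite !(@big_ltn _ _ _ j n) ?(ltnW lt_jn) // !(@big_ltn _ _ _ j.+1 n) //=.
rewrite !(Monoid.mulmA op (_ j) (_ j.+1)); congr (op _ (op _ _)) => //;
  by apply: eq_big_nat => i lt_i; apply: eq_off; lia.
Qed.

Definition pair_sum (c : nat) (H : nat -> nat -> nat) : nat :=
  \sum_(1 <= i < c.+1) \sum_(1 <= k < c.+1 | i < k) H i k.

Lemma eq_pair_sum c (H H' : nat -> nat -> nat) :
  (forall i k, 0 < i -> i < k -> k <= c -> H i k = H' i k) -> pair_sum c H = pair_sum c H'.
Proof.
move=> eqH; apply: eq_big_nat => i lt_i.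
rewrite big_nat_cond [RHS]big_nat_cond; apply: eq_bigr => k /andP[lt_k lt_ik]; apply: eqH; lia.
Qed.

Lemma pair_sumD c (H H' : nat -> nat -> nat) :
  pair_sum c (fun i k => H i k + H' i k) = pair_sum c H + pair_sum c H'.
Proof. by rewrite /pair_sum -big_split; apply: eq_bigr => i _; rewrite -big_split. Qed.

Lemma leq_pair_sum c (H H' : nat -> nat -> nat) :
  (forall i k, 0 < i -> i < k -> k <= c -> H i k <= H' i k) -> pair_sum c H <= pair_sum c H'.
Proof.
move=> leH; rewrite /pair_sum big_nat [leqRHS]big_nat; apply: leq_sum => i lt_i.
rewrite big_nat_cond [leqRHS]big_nat_cond; apply: leq_sum => k /andP[lt_k lt_ik]; apply: leH; lia.
Qed.

Lemma pair_sum_transp c j H : 0 < j < c ->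
  pair_sum c (fun i k => H (transp j i) (transp j k)) + H j j.+1 = pair_sum c H + H j.+1 j.
Proof.
case/andP=> j_gt0 lt_jc; set ind := index_iota 1 c.+1.
have perm_ind : perm_eq (map (transp j) ind) ind by apply: perm_map_transp.
have pick (a b : nat) : a \in ind -> b \in ind ->
    H a b = \sum_(i <- ind) \sum_(k <- ind) (i == a) * ((k == b) * H i k).
  rewrite !mem_index_iota => lt_a lt_b; under eq_bigr do rewrite -big_distrr /=.
  by rewrite sum_nat_pick // sum_nat_pick.
rewrite [X in _ + X = _]pick ?mem_index_iota; [|lia..].
rewrite [X in _ = _ + X]pick ?mem_index_iota; [|lia..].
rewrite /pair_sum -(perm_big _ perm_ind) big_map /= -!big_split /=; apply: eq_big_nat => i lt_i.
rewrite big_mkcond [X in _ = X + _]big_mkcond -(perm_big _ perm_ind) big_map /= -!big_split /=.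
apply: eq_big_nat => k lt_k; rewrite !transpK !mulnbl /transp.
by have [] := ltnP i k; do !case: eqP => ? //=; case: ifP; lia.
Qed.

Lemma pair_sum_exchange c j (A B : nat -> letter) : 0 < j < c ->
  quinv_trip (A j) (B j) (B j.+1) = quinv_trip (A j.+1) (B j) (B j.+1) ->
  pair_sum c (fun i k => quinv_trip (A (transp j i)) (B i) (B k)) =
  pair_sum c (fun i k => quinv_trip (A i) (B i) (B k)).
Proof.
case/andP=> j_gt0 lt_jc eq_trip.
apply: (eq_big_nat_adjacent (j := j)); rewrite ?ltnS //=; last first.
  by move=> i lt_i ne_j ne_jS; rewrite transpD.
have split_jS F : \sum_(1 <= k < c.+1 | j < k) F k = F j.+1 + \sum_(1 <= k < c.+1 | j.+1 < k) F k.
  by rewrite -!(big_nat_widenl _ _ _ xpredT) // big_ltn.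
rewrite !split_jS transpL transpR -eq_trip -!addnA -!big_split /=; congr (_ + _).
by apply: eq_bigr => k _; apply: quinv_trip_exchange.
Qed.

(** * Row decomposition of maj and quinv *)

Definition conj_part (lam : seq nat) (r : nat) : nat := count (leq r) lam.

Definition supported (lam : seq nat) (s : filling) : Prop :=
  forall r i, ~~ in_dg lam (r, i) -> s r i = zero_letter.

Definition super_filling (lam : seq nat) (N : nat) (s : filling) : Prop :=
  supported lam s /\ (forall u, u \in cells lam -> (0 < absl (entry s u) <= N)).

Definition maj_row (lam : seq nat) (r : nat) (A B : nat -> letter) : nat :=
  \sum_(1 <= i < (conj_part lam r).+1) (1 < r) * Iind (A i) (B i) * (lamc lam i - r + 1).

Definition quinv_row (lam : seq nat) (r : nat) (A B : nat -> letter) : nat :=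
  pair_sum (conj_part lam r) (fun i k => quinv_trip (A i) (B i) (B k)).

Lemma mem_cells lam u : (u \in cells lam) = in_dg lam u.
Proof.
case: u => r i; rewrite /in_dg /=.
apply/allpairsPdep/idP => [[i' [r' [i'_in r'_in [-> ->]]]]|ri_in].
  by move: i'_in r'_in; rewrite !mem_iota; lia.
by exists i, r; rewrite !mem_iota; split => //; lia.
Qed.

Lemma cells_uniq lam : uniq (cells lam).
Proof.
apply: allpairs_uniq_dep => [|i _|[i r] [i' r'] _ _ /= [-> ->]//]; exact: iota_uniq.
Qed.

Section RowDecomposition.

Variable lam : seq nat.
Hypothesis lamP : is_partition lam.

Lemma leq_lamc r i : 0 < r -> 0 < i -> (r <= lamc lam i) = (i <= conj_part lam r).
Proof.
case: lamP => lam_sorted _ r_gt0; case: i => // i _; rewrite /lamc /conj_part /=.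
elim: lam lam_sorted i => [|x l IH] /=; first by move=> _ i; rewrite nth_nil; lia.
rewrite path_sortedE; last by move=> m n p /=; lia.
case/andP => /allP l_le_x l_sorted i; case: (leqP r x) => /= le_rx.
  by case: i => [|i]; rewrite /= ?le_rx // IH.
have no_part : ~~ has (leq r) l by apply/hasPn => y /l_le_x /= le_yx; rewrite -ltnNge; lia.
have count0 : count (leq r) l = 0 by apply/eqP; rewrite -leqn0 leqNgt -has_count.
by case: i => [|i] /=; rewrite ?IH // count0; lia.
Qed.

Lemma in_dg_conj r i : in_dg lam (r, i) = [&& 0 < r, 0 < i & i <= conj_part lam r].
Proof.
rewrite /in_dg /=; case: r => [|r]; first by rewrite /= !andbF.
case: i => [|i] //=; rewrite leq_lamc //=; case: leqP => //= le_size; apply/esym/negbTE.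
by rewrite -leqNgt; apply: leq_trans le_size; exact: count_size.
Qed.

Lemma leq_head r : 0 < r -> (r <= head 0 lam) = (0 < conj_part lam r).
Proof. by move=> r_gt0; rewrite -nth0 -[nth 0 lam 0]/(lamc lam 1) leq_lamc. Qed.

Lemma lamc_head i : 0 < i -> lamc lam i <= head 0 lam.
Proof.
have [->//|lamc_gt0 i_gt0] := posnP (lamc lam i); rewrite leq_head //.
by apply: (leq_trans i_gt0); rewrite -leq_lamc.
Qed.

Lemma in_dg_row r i : in_dg lam (r, i) -> 1 <= r < (head 0 lam).+1.
Proof.
by case/and4P=> /= i_gt0 _ -> le_r; rewrite ltnS; apply: leq_trans le_r (lamc_head i_gt0).
Qed.

Lemma perm_cells_rows :
  perm_eq (cells lam)
    [seq (r, i) | r <- index_iota 1 (head 0 lam).+1, i <- index_iota 1 (conj_part lam r).+1].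
Proof.
apply: uniq_perm; first exact: cells_uniq.
  apply: allpairs_uniq_dep => [|r _|[r i] [r' i'] _ _ /= [-> ->]//]; exact: iota_uniq.
case=> r i; rewrite mem_cells; apply/idP/allpairsPdep => [ri_in|[r' [i' [r'_in i'_in [-> ->]]]]].
  exists r, i; rewrite !mem_index_iota (in_dg_row ri_in); split => //.
  by move: ri_in; rewrite in_dg_conj; lia.
by move: r'_in i'_in; rewrite in_dg_conj !mem_index_iota; lia.
Qed.

Lemma big_cells_rows (R : Type) (idx : R) (op : Monoid.com_law idx) (F : cell -> R) :
  \big[op/idx]_(u <- cells lam) F u =
  \big[op/idx]_(1 <= r < (head 0 lam).+1) \big[op/idx]_(1 <= i < (conj_part lam r).+1) F (r, i).
Proof. by rewrite (perm_big _ perm_cells_rows) /= big_allpairs_dep. Qed.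

Lemma maj_rows s : maj lam s = \sum_(1 <= r < (head 0 lam).+1) maj_row lam r (s r) (s r.-1).
Proof.
rewrite /maj big_mkcond big_cells_rows /=; apply: eq_bigr => r _.
apply: eq_bigr => i _; rewrite /leg /entry /=.
by case: (1 < r); case: Iind; rewrite /= ?mul0n ?mul1n.
Qed.

(* A degenerate triple is a triple whose top cell, being outside the diagram,
   carries the letter 0. *)
Lemma quinv_trip_supported s r i b c : supported lam s -> 0 < i -> 0 < r <= lamc lam i ->
  (in_dg lam (r.+1, i) && quinv_trip (s r.+1 i) b c) +
    ((lamc lam i == r) && quinv_trip zero_letter b c) = quinv_trip (s r.+1 i) b c.
Proof.
move=> s_supp i_gt0 /andP[r_gt0 le_r].
have dg_above : in_dg lam (r.+1, i) = (r < lamc lam i) by rewrite in_dg_conj i_gt0 -leq_lamc.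
move: le_r; rewrite dg_above; case: ltngtP => //= eq_r _; first by rewrite addn0.
by rewrite s_supp // dg_above eq_r ltnn.
Qed.

Lemma quinv_rows s : supported lam s ->
  quinv lam s = \sum_(1 <= r < (head 0 lam).+1) quinv_row lam r (s r.+1) (s r).
Proof.
move=> s_supp; rewrite /quinv /quinv_nondeg /quinv_deg -big_split /=.
under eq_bigr do rewrite -big_split /=.
rewrite big_cells_rows; apply: eq_big_nat => r lt_r; apply: eq_big_nat => i lt_i.
have le_r : 0 < r <= lamc lam i by rewrite leq_lamc; lia.
have i_gt0 : 0 < i by lia.
transitivity (\sum_(1 <= r' < (head 0 lam).+1) (r' == r) *
    \sum_(1 <= k < (conj_part lam r').+1 | i < k) quinv_trip (s r.+1 i) (s r i) (s r' k)).
  rewrite big_cells_rows; apply: eq_bigr => r' _; rewrite [in RHS]big_mkcond big_distrr /=.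
  apply: eq_bigr => k _; rewrite /deg_triple /entry /= (eq_sym r').
  have [<-|_] /= := eqVneq; last by rewrite mul0n.
  by rewrite mul1n; case: ltnP => //= _; rewrite quinv_trip_supported.
by rewrite sum_nat_pick.
Qed.

End RowDecomposition.

(** * Exchanging adjacent columns of equal height *)

Section ColumnSwap.

Variables (lam : seq nat) (h j : nat).

(* Row [r] of columns [j], [j+1] must be exchanged together with row [r+1]
   exactly when exchanging row [r+1] alone would alter a triple. *)
Definition swap_diff (s : filling) (r : nat) : bool :=
  quinv_trip (s r.+1 j) (s r j) (s r j.+1) != quinv_trip (s r.+1 j.+1) (s r j) (s r j.+1).

Definition swapped (s : filling) (r : nat) : bool := all (swap_diff s) (index_iota r h).

Definition swap_cell (s : filling) (u : cell) : cell :=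
  (u.1, if swapped s u.1 then transp j u.2 else u.2).

Definition col_swap (s : filling) : filling := fun r i => entry s (swap_cell s (r, i)).

Lemma swapped_geq s r : h <= r -> swapped s r.
Proof. by rewrite /swapped /index_iota -subn_eq0 => /eqP ->. Qed.

Lemma swapped_ltn s r : r < h -> swapped s r = swap_diff s r && swapped s r.+1.
Proof. by move=> lt_rh; rewrite /swapped /index_iota -(subnSK lt_rh). Qed.

Lemma swap_diff_col_swap s r : swap_diff (col_swap s) r = swap_diff s r.
Proof.
rewrite /swap_diff /col_swap /entry /=; case: (swapped s r); case: (swapped s r.+1);
  by rewrite ?transpL ?transpR // ?(quinv_trip_neqC _ _ (s r j.+1)) // eq_sym.
Qed.

Lemma swapped_col_swap s r : swapped (col_swap s) r = swapped s r.
Proof. by apply: eq_all => r'; apply: swap_diff_col_swap. Qed.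

Lemma swap_cellK s : involutive (swap_cell s).
Proof. by case=> r i; rewrite /swap_cell /=; case: swapped; rewrite ?transpK. Qed.

Lemma col_swapK : involutive col_swap.
Proof.
move=> s; apply: functional_extensionality => r; apply: functional_extensionality => i.
rewrite {1}/col_swap /entry /= swapped_col_swap /col_swap /entry /=.
by case: swapped; rewrite ?transpK.
Qed.

Hypotheses (lamP : is_partition lam) (j_gt0 : 0 < j).
Hypotheses (lamc_j : lamc lam j = h) (lamc_jS : lamc lam j.+1 = h).

Lemma ltn_conj_part r : 0 < r -> (j < conj_part lam r) = (r <= h).
Proof. by move=> r_gt0; rewrite -leq_lamc // lamc_jS. Qed.

Lemma conj_part_ltn r : h < r -> conj_part lam r < j.
Proof. by move=> lt_hr; rewrite ltnNge -leq_lamc ?lamc_j -?ltnNge ?(leq_ltn_trans _ lt_hr). Qed.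

Lemma in_dg_swap s u : in_dg lam (swap_cell s u) = in_dg lam u.
Proof.
case: u => r i; rewrite /swap_cell /=; case: swapped => //.
rewrite !in_dg_conj //; have [->|r_gt0] //= := posnP r.
have := ltn_conj_part r_gt0; have := @conj_part_ltn r.
by rewrite /transp; case: eqP => [->|_]; [|case: eqP => [->|_]]; lia.
Qed.

Lemma perm_swap_cells s : perm_eq (map (swap_cell s) (cells lam)) (cells lam).
Proof.
apply: uniq_perm; rewrite ?(map_inj_uniq (inv_inj (swap_cellK s))) ?cells_uniq // => u.
by rewrite -[u in LHS](swap_cellK s) (mem_map (inv_inj (swap_cellK s))) !mem_cells in_dg_swap.
Qed.

Lemma supported_col_swap s : supported lam s -> supported lam (col_swap s).
Proof. by move=> s_supp r i; rewrite -(in_dg_swap s) => /s_supp. Qed.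

Lemma super_filling_col_swap N s : super_filling lam N s -> super_filling lam N (col_swap s).
Proof.
case=> s_supp s_bounded; split=> [|u u_in]; first exact: supported_col_swap.
by apply: (s_bounded (swap_cell s u)); rewrite mem_cells in_dg_swap -?mem_cells.
Qed.

Lemma count_col_swap (P : pred letter) s :
  count (fun u => P (entry (col_swap s) u)) (cells lam) =
  count (fun u => P (entry s u)) (cells lam).
Proof. by rewrite -[RHS](permP (perm_swap_cells s)) count_map; apply: eq_count => -[]. Qed.

Lemma all_col_swap (P : nat -> letter -> bool) s :
  all (fun u => P u.1 (entry (col_swap s) u)) (cells lam) =
  all (fun u => P u.1 (entry s u)) (cells lam).
Proof. by rewrite -[RHS](perm_all _ (perm_swap_cells s)) all_map; apply: eq_all => -[]. Qed.

Lemma maj_row_col_swap s r : 1 < r ->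
  maj_row lam r (col_swap s r) (col_swap s r.-1) = maj_row lam r (s r) (s r.-1).
Proof.
case: r => // r r_gt0; rewrite /maj_row /col_swap /entry /=.
have [lt_rh|le_hr] := ltnP r h; last first.
  have := @conj_part_ltn r.+1; rewrite ltnS le_hr => /(_ isT) lt_j.
  apply: eq_big_nat => i lt_i; rewrite !transpD ?if_same //; lia.
rewrite (swapped_ltn _ lt_rh); case: (swapped s r.+1); rewrite ?andbF ?andbT //.
apply: (eq_big_nat_adjacent (j := j)) => //=; first by rewrite ltnS ltn_conj_part.
  rewrite lamc_j lamc_jS transpL transpR -!mulnDl -!mulnDr; congr (_ * _ * _).
  by case: (boolP (swap_diff s r)) => [_|/negbNE/eqP/Iind_exchange]; first by rewrite addnC.
by move=> i _ ne_j ne_jS; rewrite transpD // if_same.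
Qed.

Lemma maj_col_swap s : maj lam (col_swap s) = maj lam s.
Proof.
rewrite !maj_rows //; apply: eq_big_nat => -[|[|r]] // _; exact: maj_row_col_swap.
Qed.

Lemma quinv_row_col_swap s r : 0 < r -> r != h ->
  quinv_row lam r (col_swap s r.+1) (col_swap s r) = quinv_row lam r (s r.+1) (s r).
Proof.
move=> r_gt0; rewrite /quinv_row /col_swap /entry /=; case: ltngtP => // [lt_rh|lt_hr] _.
  have lt_j : 0 < j < conj_part lam r by rewrite j_gt0 ltn_conj_part // ltnW.
  rewrite (swapped_ltn _ lt_rh); case: (swapped s r.+1); rewrite ?andbF ?andbT //.
  case: (boolP (swap_diff s r)) => [diff|/negbNE/eqP]; last exact: pair_sum_exchange.
  have := pair_sum_transp (fun i k => quinv_trip (s r.+1 i) (s r i) (s r k)) lt_j.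
  by rewrite (quinv_trip_swap diff) => /addIn.
have lt_j := conj_part_ltn lt_hr; rewrite !swapped_geq ?(ltnW lt_hr) ?leqW ?(ltnW lt_hr) //.
by apply: eq_pair_sum => i k i_gt0 lt_ik le_k; rewrite !transpD //; lia.
Qed.

Lemma quinv_top_row_col_swap s : supported lam s -> 0 < h ->
  quinv_row lam h (col_swap s h.+1) (col_swap s h) + Iind (s h j.+1) (s h j) =
  quinv_row lam h (s h.+1) (s h) + Iind (s h j) (s h j.+1).
Proof.
move=> s_supp h_gt0; have lt_j : 0 < j < conj_part lam h by rewrite j_gt0 ltn_conj_part ?leqnn.
have := pair_sum_transp (fun i k => quinv_trip (s h.+1 i) (s h i) (s h k)) lt_j.
have above k : lamc lam k = h -> s h.+1 k = zero_letter.
  by move=> lamc_k; apply: s_supp; rewrite /in_dg /= lamc_k ltnn !andbF.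
by rewrite !above // !quinv_trip0 /quinv_row /col_swap /entry /= !swapped_geq.
Qed.

Lemma quinv_col_swap s : supported lam s -> 0 < h ->
  quinv lam (col_swap s) + Iind (s h j.+1) (s h j) = quinv lam s + Iind (s h j) (s h j.+1).
Proof.
move=> s_supp h_gt0; rewrite !quinv_rows //; last exact: supported_col_swap.
have h_in : h \in index_iota 1 (head 0 lam).+1.
  by rewrite mem_index_iota h_gt0 ltnS -lamc_j lamc_head.
apply: (eq_sum_but_one (i0 := h)) => //; rewrite ?iota_uniq ?quinv_top_row_col_swap // => r.
by rewrite mem_index_iota => /andP[r_gt0 _]; apply: quinv_row_col_swap.
Qed.

End ColumnSwap.

(** * The word of a block of columns of equal height *)

(* [Some b] stands for a letter of absolute value [a], negative iff [b]. *)
Definition letter_mark (a : nat) (x : letter) : option bool :=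
  if absl x == a then Some (is_neg x) else None.

(* Agrees with [Iind y x] as soon as [x] or [y] has absolute value [a]; pairs of
   other letters are not counted. *)
Definition coinv_pair (x y : option bool) : bool :=
  match x, y with
  | _, Some true => true
  | Some false, None => true
  | _, _ => false
  end.

Fixpoint coinv (p : seq (option bool)) : nat :=
  if p is x :: w then count (coinv_pair x) w + coinv w else 0.

Definition nmarked (p : seq (option bool)) : nat := count isSome p.

Definition nneg_word (p : seq (option bool)) : nat := count (pred1 (Some true)) p.

Lemma coinv_pair_letter_mark a b c : a <= absl b -> a <= absl c -> (absl b == a) || (absl c == a) ->
  coinv_pair (letter_mark a b) (letter_mark a c) = Iind c b.
Proof.
case: b c => [b sb] [c sc]; rewrite /letter_mark /Iind /lt2 /absl /is_neg /= !xpair_eqE.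
case: (ltngtP a b) => [lt_ab|//|eq_ab] _; case: (ltngtP a c) => [lt_ac|//|eq_ac] _ //= _; subst;
  by case: sb; case: sc; rewrite /= ?eqxx ?ltnn ?andbF ?orbT //; lia.
Qed.

Lemma coinv_pair_letter_mark_leq a b c : a <= absl b -> a <= absl c ->
  coinv_pair (letter_mark a b) (letter_mark a c) <= Iind c b.
Proof.
move=> le_ab le_ac.
have [/coinv_pair_letter_mark -> //|] := boolP ((absl b == a) || (absl c == a)).
by rewrite negb_or /letter_mark => /andP[/negbTE -> /negbTE ->].
Qed.

Lemma coinv_swap u x y v :
  coinv (u ++ x :: y :: v) + coinv_pair y x = coinv (u ++ y :: x :: v) + coinv_pair x y.
Proof. by elim: u => [|z u IH] /=; rewrite ?count_cat /=; lia. Qed.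

Lemma coinv_map_iota (f : nat -> option bool) m n :
  coinv [seq f i | i <- index_iota m n] =
  \sum_(m <= i < n) \sum_(i.+1 <= k < n) coinv_pair (f i) (f k).
Proof.
move def_d: (n - m) => d; elim: d m def_d => [|d IH] m def_d.
  by rewrite /index_iota def_d big_nil.
have index_iotaS : index_iota m n = m :: index_iota m.+1 n.
  by rewrite /index_iota def_d (_ : n - m.+1 = d) //; lia.
rewrite big_ltn -?IH ?index_iotaS; [|lia..].
by rewrite /= count_map -sum1_count big_mkcond.
Qed.

Definition block_start (lam : seq nat) (r : nat) : nat := (conj_part lam r.+1).+1.

Definition block (lam : seq nat) (r : nat) : seq nat :=
  index_iota (block_start lam r) (conj_part lam r).+1.

Definition block_word (lam : seq nat) (a r : nat) (s : filling) : seq (option bool) :=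
  [seq letter_mark a (s r i) | i <- block lam r].

Definition admissible_letter (a r k : nat) (x : letter) : bool :=
  ((a <= absl x) || (k <= absl x)) && ((r < k) ==> (absl x != a)).

(* With an entry of absolute value [a < r] in row [r], this says that [a] is the
   distinguished label and [r] the row of the distinguished cell. *)
Definition admissible (lam : seq nat) (a r : nat) (s : filling) : bool :=
  all (fun u => admissible_letter a r u.1 (entry s u)) (cells lam).

Lemma admissible_col_swap lam a r h j s : is_partition lam -> 0 < j ->
  lamc lam j = h -> lamc lam j.+1 = h ->
  admissible lam a r (col_swap h j s) = admissible lam a r s.
Proof.
move=> lamP j_gt0 lamc_j lamc_jS.
exact: (all_col_swap lamP j_gt0 lamc_j lamc_jS (admissible_letter a r)).
Qed.

Lemma coinv_block_word lam a r s : coinv (block_word lam a r s) =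
  pair_sum (conj_part lam r) (fun i k => (block_start lam r <= i) *
    coinv_pair (letter_mark a (s r i)) (letter_mark a (s r k))).
Proof.
rewrite coinv_map_iota /= (big_nat_widenl _ 1) //= big_mkcond; apply: eq_bigr => i _.
rewrite (big_nat_widenl _ 1) //=; have [_|_] := leqP (block_start lam r) i; last by rewrite big1.
by apply: eq_bigr => k _; rewrite mul1n.
Qed.

Lemma mem_block lam r i : is_partition lam -> 0 < r ->
  (i \in block lam r) = (0 < i) && (lamc lam i == r).
Proof.
move=> lamP r_gt0; rewrite mem_index_iota; case: i => // i.
have := leq_lamc lamP r_gt0 (ltn0Sn i); have := leq_lamc lamP (ltn0Sn r) (ltn0Sn i).
by rewrite /block_start; lia.
Qed.

Lemma mem_block_cells lam r i : is_partition lam -> 0 < r ->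
  i \in block lam r -> (r, i) \in cells lam.
Proof. by move=> lamP r_gt0; rewrite mem_index_iota mem_cells in_dg_conj // /block_start; lia. Qed.

Lemma in_dg_block_start lam r : is_partition lam -> 0 < r ->
  in_dg lam (r, block_start lam r) = (0 < size (block lam r)).
Proof. by move=> lamP r_gt0; rewrite in_dg_conj // size_iota /block_start; lia. Qed.

Section Admissible.

Variables (lam : seq nat) (a r : nat) (s : filling).
Hypotheses (lamP : is_partition lam) (s_supp : supported lam s).

Lemma supported_above_block i : block_start lam r <= i -> s r.+1 i = zero_letter.
Proof.
by move=> le_i; apply: s_supp; rewrite in_dg_conj //; move: le_i; rewrite /block_start; lia.
Qed.

Hypothesis s_adm : admissible lam a r s.

Lemma admissible_geq k i : a <= k -> 0 < i <= conj_part lam k -> a <= absl (s k i).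
Proof.
move=> le_ak i_in; case: (posnP k) => [k0|k_gt0]; first by move: le_ak; rewrite k0; lia.
have /allP/(_ (k, i)) := s_adm; rewrite mem_cells in_dg_conj // k_gt0 i_in => /(_ isT).
by rewrite /admissible_letter /entry /=; lia.
Qed.

Hypothesis lt_ar : a < r.

Lemma admissible_gtn k i : r < k -> 0 < i <= conj_part lam k -> a < absl (s k i).
Proof.
move=> lt_rk i_in; have := admissible_geq (ltnW (ltn_trans lt_ar lt_rk)) i_in.
have /allP/(_ (k, i)) := s_adm; rewrite mem_cells in_dg_conj // i_in (leq_ltn_trans _ lt_rk) //=.
by move=> /(_ isT) /andP[_] /=; rewrite lt_rk /entry /=; lia.
Qed.

Lemma coinv_block_word_leq_quinv : coinv (block_word lam a r s) <= quinv lam s.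
Proof.
apply: (@leq_trans (quinv_row lam r (s r.+1) (s r))).
  rewrite coinv_block_word; apply: leq_pair_sum => i k i_gt0 lt_ik le_k.
  have [le_i|_] := leqP (block_start lam r) i; last by rewrite mul0n.
  rewrite mul1n supported_above_block // quinv_trip0.
  by apply: coinv_pair_letter_mark_leq; apply: admissible_geq; lia.
rewrite quinv_rows //; have [le_head|lt_head] := leqP r (head 0 lam).
  by rewrite (bigD1_seq r) ?mem_index_iota ?iota_uniq ?leq_addr //=; lia.
have no_row : conj_part lam r = 0 by have := leq_head lamP (leq_ltn_trans (leq0n a) lt_ar); lia.
by rewrite /quinv_row /pair_sum no_row big_geq.
Qed.

End Admissible.

Lemma lamc_block lam r k : is_partition lam -> 0 < r -> k < size (block lam r) ->
  lamc lam (block_start lam r + k) = r.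
Proof.
move=> lamP r_gt0 lt_k; have : block_start lam r + k \in block lam r.
  by move: lt_k; rewrite size_iota mem_index_iota; lia.
by rewrite mem_block // => /andP[_ /eqP].
Qed.

Lemma nth_block_word lam a r s k : k < size (block lam r) ->
  nth None (block_word lam a r s) k = letter_mark a (s r (block_start lam r + k)).
Proof.
by rewrite size_iota => lt_k; rewrite (nth_map 0) ?size_iota // nth_iota.
Qed.

Section BlockSwap.

Variables (lam : seq nat) (a r : nat) (u v : seq (option bool)) (y z : option bool) (s : filling).
Hypotheses (lamP : is_partition lam) (r_gt0 : 0 < r).
Hypothesis word_s : block_word lam a r s = u ++ z :: y :: v.

Let j := block_start lam r + size u.

Lemma size_block : size (block lam r) = size u + (size v).+2.
Proof. by have := congr1 size word_s; rewrite size_map size_cat. Qed.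

Lemma block_word_cell k : k < size u + (size v).+2 ->
  [/\ lamc lam (block_start lam r + k) = r, (r, block_start lam r + k) \in cells lam
    & letter_mark a (s r (block_start lam r + k)) = nth None (u ++ z :: y :: v) k].
Proof.
rewrite -size_block => lt_k; split; first exact: lamc_block.
  by apply: mem_block_cells; rewrite // mem_block // lamc_block // eqxx.
by rewrite -word_s nth_block_word.
Qed.

Lemma block_word_col_swap : block_word lam a r (col_swap r j s) = u ++ y :: z :: v.
Proof.
apply: (@eq_from_nth _ None) => [|k]; rewrite size_map size_block ?size_cat // => lt_k.
have swap_k : transp j (block_start lam r + k) = block_start lam r + transp (size u) k.
  by rewrite /transp /j -addnS !eqn_add2l; do 2!case: eqP => // _.
have lt_swap : transp (size u) k < size u + (size v).+2.
  by rewrite /transp; do !case: eqP; lia.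
rewrite nth_block_word ?size_block // /col_swap /entry /= swapped_geq // swap_k.
by have [_ _ ->] := block_word_cell lt_swap; rewrite nth_transp.
Qed.

Lemma quinv_coinv_col_swap : supported lam s -> admissible lam a r s -> a < r ->
  isSome y || isSome z ->
  quinv lam (col_swap r j s) + coinv (u ++ z :: y :: v) = quinv lam s + coinv (u ++ y :: z :: v).
Proof.
move=> s_supp s_adm lt_ar marked_yz.
have [|lamc_j cell_j] := @block_word_cell (size u); first by lia.
have [|lamc_jS cell_jS] := @block_word_cell (size u).+1; first by lia.
rewrite !nth_cat ltnn subnn ltnNge leqnSn subSnn addnS /= in lamc_jS cell_jS *.
move=> letter_jS letter_j.
have low k : (r, k) \in cells lam -> a <= absl (s r k).
  by rewrite mem_cells in_dg_conj // => k_in; apply: (admissible_geq lamP s_adm); lia.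
have marked_j : (absl (s r j) == a) || (absl (s r j.+1) == a).
  move: marked_yz; rewrite -letter_j -letter_jS /letter_mark -/j.
  by case: (absl (s r j) == a); case: (absl (s r j.+1) == a).
have coinv_zy : coinv_pair z y = Iind (s r j.+1) (s r j).
  by rewrite -letter_j -letter_jS coinv_pair_letter_mark ?low.
have coinv_yz : coinv_pair y z = Iind (s r j) (s r j.+1).
  by rewrite -letter_j -letter_jS coinv_pair_letter_mark ?low // orbC.
have := quinv_col_swap lamP (ltn0Sn _ : 0 < j) lamc_j lamc_jS s_supp r_gt0.
by have := coinv_swap u y z v; rewrite coinv_zy coinv_yz; lia.
Qed.

End BlockSwap.

(** * Flipping the sign of the first letter of a block *)

Definition flip_cell (c : cell) (s : filling) : filling :=
  fun r i => if (r, i) == c then (absl (s r i), ~~ is_neg (s r i)) else s r i.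

Definition flip_head (p : seq (option bool)) : seq (option bool) :=
  if p is x :: w then omap negb x :: w else [::].

Lemma flip_cellK c : involutive (flip_cell c).
Proof.
move=> s; apply: functional_extensionality => r; apply: functional_extensionality => i.
by rewrite /flip_cell; case: eqP => // _; case: (s r i) => n b; rewrite /= negbK.
Qed.

Lemma flip_headK : involutive flip_head.
Proof. by case=> // -[[]|]. Qed.

Lemma nneg_word_flip_head p : nth None p 0 = Some false ->
  nneg_word (flip_head p) = (nneg_word p).+1.
Proof. by case: p => // x w /= ->. Qed.

Lemma absl_flip_cell c s u : absl (entry (flip_cell c s) u) = absl (entry s u).
Proof. by rewrite /entry /flip_cell; case: eqP. Qed.

Lemma admissible_flip_cell lam a r c s : admissible lam a r (flip_cell c s) = admissible lam a r s.
Proof. by apply: eq_all => u; rewrite /admissible_letter absl_flip_cell. Qed.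

Lemma supported_flip_cell lam c s : in_dg lam c -> supported lam s -> supported lam (flip_cell c s).
Proof.
move=> c_in s_supp r i; rewrite /flip_cell; case: eqP => [->|_]; [by rewrite c_in|exact: s_supp].
Qed.

Lemma super_filling_flip_cell lam N c s : in_dg lam c ->
  super_filling lam N s -> super_filling lam N (flip_cell c s).
Proof.
move=> c_in [s_supp s_bounded]; split=> [|u u_in]; first exact: supported_flip_cell.
by rewrite absl_flip_cell; apply: s_bounded.
Qed.

Lemma count_flip_cell lam c s (P : pred letter) : in_dg lam c ->
  count (fun u => P (entry (flip_cell c s) u)) (cells lam) + P (entry s c) =
  count (fun u => P (entry s u)) (cells lam) + P (entry (flip_cell c s) c).
Proof.
move=> c_in; rewrite -!sum1_count big_mkcond [in RHS]big_mkcond /=.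
apply: (eq_sum_but_one (i0 := c)); rewrite ?cells_uniq ?mem_cells //; first by do 2!case: (P _).
by case=> r i _ /negbTE ne_c; rewrite /entry /flip_cell /= ne_c.
Qed.

Lemma block_word_flip_cell lam a r s :
  block_word lam a r (flip_cell (r, block_start lam r) s) = flip_head (block_word lam a r s).
Proof.
rewrite /block_word /block /index_iota; case: (_ - _) => //= d; congr (_ :: _).
  by rewrite /flip_cell eqxx /letter_mark /=; case: eqP.
apply/eq_in_map => i; rewrite mem_iota => /andP[/gtn_eqF lt_i _].
by rewrite /flip_cell xpair_eqE lt_i andbF.
Qed.

Lemma nth0_block_word lam a r s : is_partition lam -> in_dg lam (r, block_start lam r) ->
  nth None (block_word lam a r s) 0 = letter_mark a (s r (block_start lam r)).
Proof.
move=> lamP block_r; have /and4P[_ _ /= r_gt0 _] := block_r.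
by rewrite nth_block_word ?addn0 // -in_dg_block_start.
Qed.

Section FlipSign.

Variables (lam : seq nat) (a r : nat) (s : filling).
Hypotheses (lamP : is_partition lam) (s_supp : supported lam s).
Hypotheses (lt_ar : a < r) (s_adm : admissible lam a r s).

Let first := block_start lam r.
Let flipped := flip_cell (r, first) s.

Hypotheses (first_in : in_dg lam (r, first)) (s_first : s r first = (a, false)).

Lemma flip_cell_off k i : (k, i) != (r, first) -> flipped k i = s k i.
Proof. by rewrite /flipped /flip_cell => /negbTE->. Qed.

Lemma flip_cell_at : flipped r first = (a, true).
Proof. by rewrite /flipped /flip_cell eqxx s_first. Qed.

Lemma maj_row_flip_cell k : k != r ->
  maj_row lam k (flipped k) (flipped k.-1) = maj_row lam k (s k) (s k.-1).
Proof.
move=> ne_kr; apply: eq_big_nat => i lt_i; rewrite !flip_cell_off // ?xpair_eqE ?(negbTE ne_kr) //.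
apply/negP => /andP[/eqP eq_k /eqP eq_i].
have k_gt0 : 0 < k by rewrite lt0n; apply: contraNneq ne_kr => k_eq0; rewrite -eq_k k_eq0.
by move: lt_i; rewrite -(prednK k_gt0) eq_k eq_i /first /block_start ltnn andbF.
Qed.

Lemma quinv_row_flip_cell k : 0 < k -> k != r ->
  quinv_row lam k (flipped k.+1) (flipped k) = quinv_row lam k (s k.+1) (s k).
Proof.
move=> k_gt0 ne_kr; apply: eq_pair_sum => i l i_gt0 lt_il le_l.
rewrite !(@flip_cell_off k) ?xpair_eqE ?(negbTE ne_kr) //.
have [[eq_k eq_i]|ne_first] := eqVneq (k.+1, i) (r, first); last by rewrite flip_cell_off.
have low m : 0 < m <= conj_part lam k -> a <= absl (s k m).
  by apply: (admissible_geq lamP s_adm); lia.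
by rewrite eq_k {1 3}eq_i flip_cell_at s_first quinv_trip_signl ?low //; lia.
Qed.

Lemma quinv_row_flip_cell_top :
  quinv_row lam r (flipped r.+1) (flipped r) + coinv (block_word lam a r s) =
  quinv_row lam r (s r.+1) (s r) + coinv (block_word lam a r flipped).
Proof.
have low i : 0 < i <= conj_part lam r -> a <= absl (s r i).
  by move=> i_in; apply: (admissible_geq lamP s_adm); lia.
have above i : flipped r.+1 i = s r.+1 i by rewrite flip_cell_off // xpair_eqE gtn_eqF.
rewrite !coinv_block_word /quinv_row -!pair_sumD; apply: eq_pair_sum => i k i_gt0 lt_ik le_k.
rewrite above; have [ge_first|lt_first] := leqP (block_start lam r) i; last first.
  have ne_first : (r, i) != (r, first) by rewrite xpair_eqE (ltn_eqF lt_first) andbF.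
  rewrite !mul0n !addn0 (flip_cell_off ne_first).
  have [[eq_k]|ne_k_first] := eqVneq (r, k) (r, first); last by rewrite flip_cell_off.
  rewrite eq_k flip_cell_at s_first quinv_trip_signr ?low //; last by lia.
  by apply: (admissible_gtn lamP s_adm); move: lt_first; rewrite /block_start; lia.
rewrite !mul1n !(supported_above_block lamP s_supp ge_first) !quinv_trip0.
have absl' l : absl (flipped r l) = absl (s r l) by apply: (absl_flip_cell _ _ (r, l)).
have [eq_a|/norP[ne_ia ne_ka]] := boolP ((absl (s r i) == a) || (absl (s r k) == a)).
  by rewrite !coinv_pair_letter_mark ?absl' ?low //; lia.
have off l : absl (s r l) != a -> flipped r l = s r l.
  by move=> ne_a; apply: flip_cell_off; apply: contraNneq ne_a => -[->]; rewrite s_first.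
by rewrite !off.
Qed.

Lemma quinv_flip_cell :
  quinv lam flipped + coinv (block_word lam a r s) =
  quinv lam s + coinv (block_word lam a r flipped).
Proof.
rewrite !quinv_rows //; last exact: supported_flip_cell.
apply: (eq_sum_but_one (i0 := r)); rewrite ?iota_uniq ?quinv_row_flip_cell_top //.
  by rewrite mem_index_iota (in_dg_row lamP first_in).
by move=> k; rewrite mem_index_iota => /andP[k_gt0 _]; apply: quinv_row_flip_cell.
Qed.

Hypothesis a_gt0 : 0 < a.

Lemma maj_row_flip_cell_top :
  maj_row lam r (flipped r) (flipped r.-1) = maj_row lam r (s r) (s r.-1) + 1.
Proof.
have [r_gt1 le_first] : 1 < r /\ first <= conj_part lam r.
  by move: first_in; rewrite in_dg_conj //; lia.
have ne_rr1 i : (r.-1, i) != (r, first) by rewrite xpair_eqE; lia.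
have /andP[_ /eqP lamc_first] : (0 < first) && (lamc lam first == r).
  by rewrite -mem_block ?mem_index_iota ?leqnn ?ltnS //; lia.
have first_gt0 : 0 < first by [].
have first_below : first <= conj_part lam r.-1 by rewrite -leq_lamc ?lamc_first ?leq_pred //; lia.
have le_a : a <= absl (s r.-1 first) by apply: (admissible_geq lamP s_adm); lia.
rewrite -[LHS]addn0; apply: (eq_sum_but_one (i0 := first)); rewrite ?iota_uniq ?mem_index_iota //.
  by rewrite flip_cell_at s_first flip_cell_off // Iind_posl // Iind_negl // r_gt1 lamc_first subnn.
by move=> i _ ne_first; rewrite !flip_cell_off // xpair_eqE (negbTE ne_first) andbF.
Qed.

Lemma maj_flip_cell : maj lam flipped = maj lam s + 1.
Proof.
rewrite !maj_rows // -[LHS]addn0; apply: (eq_sum_but_one (i0 := r)); rewrite ?iota_uniq //.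
- by rewrite mem_index_iota (in_dg_row lamP first_in).
- by rewrite addn0 maj_row_flip_cell_top.
by move=> k _; apply: maj_row_flip_cell.
Qed.

End FlipSign.

(** * The distinguished label and cell *)

Definition reading_lt (u v : cell) : bool := (v.1 < u.1) || ((u.1 == v.1) && (v.2 < u.2)).

Lemma pairwise_reading lam : pairwise reading_lt (reading lam).
Proof.
apply: pairwise_filter; have rev_iota n : pairwise gtn (rev (iota 1 n)).
  rewrite -sorted_pairwise ?rev_sorted ?iota_ltn_sorted // => l k m /= lt_lk lt_ml.
  exact: ltn_trans lt_ml lt_lk.
move: (rev _) (rev_iota (head 0 lam)) (rev _) (rev_iota (size lam)) => rows rows_gt cols cols_gt.
elim: rows rows_gt => //= r rows IH /andP[/allP gt_r /IH IHrows].
rewrite pairwise_cat IHrows andbT; apply/andP; split.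
  apply/allrelP => u v /mapP[i _ ->] /allpairsP[[r' i'] /= [/gt_r /= lt_r _ ->]].
  by rewrite /reading_lt /= lt_r.
rewrite pairwise_map; apply: sub_pairwise cols_gt => i k /= lt_ki.
by rewrite /reading_lt /= eqxx lt_ki orbT.
Qed.

Lemma in_deg_tripleP lam r i : is_partition lam -> 0 < r ->
  in_deg_triple lam (r, i) <->
  exists k l, [/\ k \in block lam r, l \in block lam r, k < l & (i == k) || (i == l)].
Proof.
move=> lamP r_gt0; split=> [/hasP[[ru k] u_in /hasP[[rv l] v_in]]|[k [l [k_in l_in lt_kl i_kl]]]].
  case/andP=> /and3P[/= /eqP eq_rv lt_kl /eqP lamc_k] i_kl.
  have eq_ru : ru = r by move: i_kl; rewrite !xpair_eqE; lia.
  rewrite -eq_rv eq_ru !xpair_eqE eqxx /= in u_in v_in lamc_k i_kl.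
  have k_block : k \in block lam r.
    by move: u_in; rewrite mem_cells in_dg_conj // mem_block // lamc_k eqxx; lia.
  exists k, l; split => //.
  by move: k_block v_in; rewrite mem_cells in_dg_conj // !mem_index_iota; lia.
apply/hasP; exists (r, k); first exact: mem_block_cells.
apply/hasP; exists (r, l); first exact: mem_block_cells.
by move: k_in; rewrite /deg_triple !xpair_eqE mem_block //= !eqxx lt_kl i_kl => /andP[_ ->].
Qed.

Lemma in_deg_tripleE lam r i : is_partition lam -> 0 < r ->
  in_deg_triple lam (r, i) = (i \in block lam r) && (1 < size (block lam r)).
Proof.
move=> lamP r_gt0; have degP := in_deg_tripleP i lamP r_gt0.
apply/idP/andP => [/degP[k [l [k_in l_in lt_kl i_kl]]]|[i_in size_gt1]]; last apply/degP.
  split; first by case/orP: i_kl => /eqP->.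
  by move: k_in l_in; rewrite size_iota !mem_index_iota; lia.
have first_in : block_start lam r \in block lam r.
  by move: size_gt1; rewrite size_iota mem_index_iota; lia.
have [eq_i|ne_i] := eqVneq i (block_start lam r).
  exists i, i.+1; rewrite eqxx; split => //.
  by move: size_gt1; rewrite size_iota mem_index_iota eq_i; lia.
exists (block_start lam r), i; rewrite eqxx orbT; split => //.
by move: i_in; rewrite mem_index_iota; lia.
Qed.

Definition dist_key (lam : seq nat) (s : filling) : option (nat * nat) :=
  if dlabel lam s is Some a then omap (fun w => (a, w.1)) (dcell lam s a) else None.

Section Distinguished.

Variables (lam : seq nat) (s : filling) (a : nat).
Hypothesis lamP : is_partition lam.

Lemma mem_reading u : (u \in reading lam) = (u \in cells lam).
Proof.
rewrite mem_cells mem_filter; case: (boolP (in_dg lam u)) => //= u_in.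
apply/allpairsP; exists u; rewrite !mem_rev !mem_iota; case: u u_in => r i u_in.
have := in_dg_row lamP u_in; have /and4P[/= i_gt0 le_i _ _] := u_in.
by split => //=; lia.
Qed.

Lemma dcell_first w : dcell lam s a = Some w ->
  [/\ w \in cells lam, absl (entry s w) = a &
   forall v : cell, v \in cells lam -> absl (entry s v) = a ->
     (v.1 < w.1) || ((v.1 == w.1) && (v.2 <= w.2))].
Proof.
rewrite /dcell; set l := [seq u <- _ | _].
have mem_l u : (u \in l) = (absl (entry s u) == a) && (u \in cells lam).
  by rewrite mem_filter mem_reading.
have : pairwise reading_lt l by apply: pairwise_filter; apply: pairwise_reading.
case: l mem_l => //= w' l mem_l /andP[/allP w_first _] [<-].
have := mem_l w'; rewrite mem_head => /esym/andP[/eqP abs_w w_in]; split => // v v_in abs_v.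
have := mem_l v; rewrite abs_v eqxx v_in inE => /orP[/eqP ->|/w_first].
  by rewrite eqxx leqnn orbT.
by rewrite /reading_lt; lia.
Qed.

Lemma dcell_some u : u \in cells lam -> absl (entry s u) = a -> exists w, dcell lam s a = Some w.
Proof.
move=> u_in abs_u; rewrite /dcell; set l := [seq u <- _ | _].
have : u \in l by rewrite mem_filter abs_u eqxx mem_reading.
by case: l => // w l _; exists w.
Qed.

Variable N : nat.
Hypothesis s_filling : super_filling lam N s.

Lemma dlabelP : dlabel lam s = Some a <->
  (exists2 u : cell, u \in cells lam & absl (entry s u) = a /\ a < u.1) /\
  (forall u : cell, u \in cells lam -> absl (entry s u) < u.1 -> a <= absl (entry s u)).
Proof.
rewrite /dlabel; set l := map _ _.
have mem_l b : b \in l <-> exists2 u : cell, u \in cells lam & absl (entry s u) = b /\ b < u.1.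
  split=> [/mapP[u]|[u u_in [abs_u lt_bu]]].
    by rewrite mem_filter => /andP[/andP[_ lt_u] u_in] ->; exists u.
  have /andP[abs_gt0 _] := s_filling.2 u u_in.
  by apply/mapP; exists u; rewrite // mem_filter abs_gt0 abs_u lt_bu.
case: l mem_l => [|b l] mem_l; first by split=> // -[/mem_l].
split=> [[<-]|[/mem_l a_in a_min]].
  split=> [|u u_in lt_u]; first exact/mem_l/mem_foldr_minn.
  by apply/foldr_minn_leq/mem_l; exists u.
congr Some; apply/eqP; rewrite eqn_leq foldr_minn_leq //=.
by have [u u_in [<- lt_u]] := (mem_l _).1 (mem_foldr_minn b l); apply: a_min.
Qed.

Lemma dist_keyP r : dist_key lam s = Some (a, r) <->
  [/\ a < r, admissible lam a r s & exists2 i, (r, i) \in cells lam & absl (s r i) = a].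
Proof.
rewrite /dist_key; split=> [|[lt_ar s_adm [i i_in abs_i]]].
  case def_a: (dlabel lam s) => [a'|] //.
  case def_w: (dcell lam s a') => [w|] // [eq_a eq_r]; rewrite eq_a in def_a def_w.
  have [w_in abs_w w_first] := dcell_first def_w.
  have [[u u_in [abs_u lt_u]] a_min] := dlabelP.1 def_a.
  split; last by exists w.2; rewrite -eq_r; [case: (w) w_in|].
  - by have := w_first u u_in abs_u; lia.
  apply/allP => v v_in; have := a_min v v_in; have := w_first v v_in.
  rewrite /admissible_letter; case: (eqVneq (absl (entry s v)) a) => [->|].
    by rewrite leqnn implybF; lia.
  by rewrite implybT; lia.
have label_a : dlabel lam s = Some a.
  apply/dlabelP; split; first by exists (r, i).
  by move=> u u_in; have /allP/(_ u u_in) := s_adm; rewrite /admissible_letter; lia.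
have [w def_w] := dcell_some i_in abs_i; rewrite label_a def_w /=.
have [w_in abs_w w_first] := dcell_first def_w.
have /= first_ri := w_first _ i_in abs_i.
have le_wr : w.1 <= r.
  by have /allP/(_ w w_in) := s_adm; rewrite /admissible_letter abs_w eqxx implybF; lia.
by congr (Some (_, _)); lia.
Qed.

Lemma phi_degenerateE r : dist_key lam s = Some (a, r) ->
  phi_degenerate lam s = (1 < size (block lam r)) && (0 < nmarked (block_word lam a r s)).
Proof.
move=> key_s; have [lt_ar _ _] := (dist_keyP r).1 key_s.
move: key_s; rewrite /phi_degenerate /dist_key.
case: (dlabel lam s) => // a'; case def_w: (dcell lam s a') => [[r' i]|] // [eq_a eq_r].
rewrite eq_a /= in eq_r def_w; have [w_in abs_w w_first] := dcell_first def_w.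
have r_gt0 : 0 < r by lia.
rewrite eq_r in_deg_tripleE // andbC in w_in abs_w w_first *; congr (_ && _).
rewrite -has_count; apply/idP/hasP => [i_in|[_ /mapP[k k_in ->]]].
  by exists (letter_mark a (s r i)); [exact: map_f | rewrite /letter_mark [absl _]abs_w eqxx].
rewrite /letter_mark; case: eqP => // abs_k _.
have := w_first _ (mem_block_cells lamP r_gt0 k_in) abs_k.
by move: k_in w_in; rewrite mem_cells in_dg_conj // !mem_index_iota /=; lia.
Qed.

Lemma phi_degenerate_dist_key r : phi_degenerate lam s && (dist_key lam s == Some (a, r)) =
  [&& a < r, 1 < size (block lam r), admissible lam a r s & 0 < nmarked (block_word lam a r s)].
Proof.
apply/andP/and4P => [[deg_s /eqP key_s]|[lt_ar size_gt1 s_adm marked_s]].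
  have [lt_ar s_adm _] := (dist_keyP r).1 key_s.
  by move: deg_s; rewrite (phi_degenerateE key_s) => /andP[].
suffices key_s : dist_key lam s = Some (a, r).
  by rewrite (phi_degenerateE key_s) size_gt1 key_s eqxx.
move: marked_s; rewrite -has_count => /hasP[_ /mapP[i i_in ->]].
rewrite /letter_mark; case: eqP => // abs_i _.
by apply/dist_keyP; split => //; exists i; rewrite ?mem_block_cells //; lia.
Qed.

End Distinguished.

(** * The signed sum over words *)

Lemma word_invariant (U : Type) (A : seq (option bool) -> U) :
  (forall u x y v, A (u ++ x :: y :: v) = A (u ++ y :: x :: v)) ->
  (forall p, A (flip_head p) = A p) ->
  forall p p', size p = size p' -> nmarked p = nmarked p' -> A p = A p'.
Proof.
move=> swapA flipA p p' eq_size eq_nmarked; have permA := perm_eq_invariant swapA.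
pose unsign := omap (fun _ : bool => false).
have unsignA u w : A (u ++ w) = A (u ++ map unsign w).
  elim: w u => [|x w IH] u //=; rewrite -cat_rcons IH cat_rcons; case: x => [b|] //=.
  have frontA c : A (u ++ Some c :: map unsign w) = A (Some c :: u ++ map unsign w).
    by apply: permA; rewrite -cat1s perm_catCA.
  by rewrite !frontA; case: b => //; rewrite -flipA.
rewrite (unsignA [::] p) (unsignA [::] p') /=; apply: permA; apply/allP => x _ /=.
have count_None w : count_mem None (map unsign w) = size w - nmarked w.
  rewrite /nmarked -(count_predC isSome w) addKn count_map; apply: eq_count => -[] //.
have count_Some b w : count_mem (Some b) (map unsign w) = ~~ b * nmarked w.
  by rewrite count_map; case: b; elim: w => //= -[c|] w /= ->; lia.
by case: x => [b|]; rewrite ?count_None ?count_Some ?eq_size ?eq_nmarked.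
Qed.

Lemma count_coinv_pair_None w : count (coinv_pair None) w = nneg_word w.
Proof. by apply: eq_count => -[[]|]. Qed.

Lemma count_coinv_pair_neg w : count (coinv_pair (Some true)) w = nneg_word w.
Proof. by apply: eq_count => -[[]|]. Qed.

Lemma count_coinv_pair_pos w :
  count (coinv_pair (Some false)) w = nneg_word w + (size w - nmarked w).
Proof.
rewrite /nneg_word /nmarked -(count_predC isSome w) addKn.
by elim: w => //= -[[]|] w /= ->; lia.
Qed.

Local Open Scope ring_scope.

Fixpoint qbinomial (R : comNzRingType) (t : R) (n m : nat) : R :=
  match n, m with
  | _, 0 => 1
  | 0, _.+1 => 0
  | n'.+1, m'.+1 => t ^+ m * qbinomial t n' m + qbinomial t n' m'
  end.

Lemma qbinomial_small (R : comNzRingType) (t : R) n m : (n < m)%N -> qbinomial t n m = 0.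
Proof.
elim: n m => [|n IH] [|m] //=; rewrite ltnS => lt_nm.
by rewrite !IH // ?mulr0 ?addr0 // ltnW.
Qed.

Lemma qbinomial0 (R : comNzRingType) (t : R) n : qbinomial t n 0 = 1.
Proof. by case: n. Qed.

Lemma qbinomialS (R : comNzRingType) (t : R) n m :
  qbinomial t n.+1 m.+1 = t ^+ m.+1 * qbinomial t n m.+1 + qbinomial t n m.
Proof. by []. Qed.

Lemma qbinomialS_dual (R : comNzRingType) (t : R) n m :
  qbinomial t n.+1 m.+1 = qbinomial t n m.+1 + t ^+ (n - m) * qbinomial t n m.
Proof.
elim: n m => [|n IH] m.
  by case: m => [|m] /=; rewrite ?mulr0 ?add0r ?expr0 ?mul1r.
case: m => [|m].
  rewrite [LHS]qbinomialS {1}IH [in RHS]qbinomialS !qbinomial0 !subn0 !mulr1 !exprS; ring.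
rewrite [LHS]qbinomialS [in LHS]IH [in LHS]IH [qbinomial t n.+1 m.+2 in RHS]qbinomialS.
rewrite [qbinomial t n.+1 m.+1 in RHS]qbinomialS subSS.
have [lt_mn|le_nm] := ltnP m n; last by rewrite (@qbinomial_small _ _ n m.+1) //; ring.
by rewrite -(subnSK lt_mn) !exprS; ring.
Qed.

Definition signed_word_sum (R : comNzRingType) (t : R) (n m : nat) (z : R) : R :=
  \sum_(p : n.-tuple (option bool) | nmarked p == m) (- z) ^+ nneg_word p * t ^+ coinv p.

Lemma signed_word_sum0 (R : comNzRingType) (t : R) m z : signed_word_sum t 0 m z = (m == 0)%:R.
Proof.
rewrite /signed_word_sum; case: m => [|m] /=; last by rewrite big_pred0 // => p; rewrite tuple0.
by rewrite (big_pred1 [tuple]) ?expr0 ?mulr1 // => p; rewrite tuple0 /= [RHS]eqxx.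
Qed.

Lemma signed_word_sumS (R : comNzRingType) (t : R) n m z :
  signed_word_sum t n.+1 m z = signed_word_sum t n m (z * t)
    + (if m is m'.+1 then (t ^+ (n - m') - z) * signed_word_sum t n m' (z * t) else 0).
Proof.
rewrite /signed_word_sum (big_tuple_cons _ _ (fun p => nmarked p == m)
  (fun p => (- z) ^+ nneg_word p * t ^+ coinv p)).
rewrite big_option_bool /=; congr (_ + _).
  apply: eq_bigr => p _; rewrite /nneg_word /= -/(nneg_word p) add0n count_coinv_pair_None.
  by rewrite exprD mulrA -mulNr exprMn.
case: m => [|m]; first by rewrite !big_pred0 ?addr0 // => p; rewrite /nmarked /= add1n.
rewrite mulrBl addrC !mulr_sumr -sumrN; congr (_ + _); apply: eq_bigr => p.
  rewrite /nmarked /= add1n eqSS => /eqP nmarked_p.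
  rewrite /nneg_word /= -/(nneg_word p) add0n count_coinv_pair_pos size_tuple.
  by rewrite [nmarked p]nmarked_p -mulNr exprMn !exprD; ring.
rewrite /nneg_word /= -/(nneg_word p) count_coinv_pair_neg -!mulNr exprMn !exprD expr1.
by move=> _; ring.
Qed.

(* A form of the q-binomial theorem. *)
Lemma signed_word_sum_prod (R : comNzRingType) (t : R) n m z :
  signed_word_sum t n m z = qbinomial t n m * \prod_(k < m) (1 - z * t ^+ k).
Proof.
elim: n m z => [|n IH] [|m] z; rewrite ?signed_word_sum0 ?signed_word_sumS ?IH;
  rewrite ?big_ord0 ?qbinomial0 ?mulr1 ?addr0 //.
  by rewrite /= mul0r.
have shift : \prod_(k < m.+1) (1 - z * t ^+ k) = (1 - z) * \prod_(k < m) (1 - z * t * t ^+ k).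
  rewrite big_ord_recl /= expr0 mulr1; congr (_ * _); apply: eq_bigr => k _.
  by rewrite -mulrA -exprS.
rewrite shift [in LHS]big_ord_recr /= -[z * t * t ^+ m]mulrA -exprS.
set P := \prod_(k < m) _; set qS := qbinomial t n m.+1; set q := qbinomial t n m.
transitivity ((qS + t ^+ (n - m) * q - z * (t ^+ m.+1 * qS + q)) * P); first by ring.
by rewrite -[qS + _]qbinomialS_dual -[_ * qS + q]qbinomialS; ring.
Qed.

Lemma signed_word_sum1 (R : comNzRingType) (t : R) n m : (0 < m)%N -> signed_word_sum t n m 1 = 0.
Proof.
case: m => // m _; rewrite signed_word_sum_prod big_ord_recl /= expr0 mulr1 subrr mul0r mulr0 //.
Qed.

(** * Sums over fillings *)

Section Fill.

Variables (lam : seq nat) (N : nat).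

Local Notation encoding := ((size (cells lam)).-tuple ('I_N * bool)).

Lemma fill_nth (e : encoding) (k : 'I_(size (cells lam))) :
  entry (fill e) (nth (0, 0)%N (cells lam) k) = ((val (tnth e k).1).+1, (tnth e k).2).
Proof.
rewrite /entry /fill -surjective_pairing index_uniq ?cells_uniq //.
by rewrite (nth_map (tnth e k)) ?size_tuple // -tnth_nth.
Qed.

Lemma mem_cells_nth u : u \in cells lam ->
  exists k : 'I_(size (cells lam)), u = nth (0, 0)%N (cells lam) k.
Proof.
move=> u_in; have lt_u := u_in; rewrite -index_mem in lt_u.
by exists (Ordinal lt_u); rewrite /= nth_index.
Qed.

Lemma fill_super_filling (e : encoding) : super_filling lam N (fill e).
Proof.
split=> [r i|u /mem_cells_nth[k ->]]; last by rewrite fill_nth /absl /= ltn_ord.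
by rewrite -mem_cells => ri_out; rewrite /fill nth_default // size_map size_tuple leqNgt index_mem.
Qed.

Lemma fill_inj : injective (@fill lam N).
Proof.
move=> e e' eq_fill; apply: eq_from_tnth => k.
have := fill_nth e k; rewrite eq_fill fill_nth.
by case: (tnth e k) (tnth e' k) => [i b] [i' b'] /= [eq_i ->]; congr (_, _); apply: val_inj.
Qed.

Lemma fill_surj s : super_filling lam N s -> exists e, @fill lam N e = s.
Proof.
case=> s_supp s_bounded.
have entry_letter (k : 'I_(size (cells lam))) : exists p : 'I_N * bool,
    ((val p.1).+1, p.2) = entry s (nth (0, 0)%N (cells lam) k).
  have := s_bounded _ (mem_nth (0, 0)%N (ltn_ord k)).
  by case: (entry s _) => [[|n] b] //= lt_n; exists (Ordinal lt_n, b).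
have [f f_entry] := fin_all_exists entry_letter.
exists (mktuple f); apply: functional_extensionality => r; apply: functional_extensionality => i.
have [ri_in|ri_out] := boolP (in_dg lam (r, i)); last first.
  by have [fill_supp _] := fill_super_filling (mktuple f); rewrite fill_supp // s_supp.
rewrite -[LHS]/(entry (fill _) (r, i)) -[RHS]/(entry s (r, i)).
by move: ri_in; rewrite -mem_cells => /mem_cells_nth[k ->]; rewrite fill_nth tnth_mktuple.
Qed.

Lemma big_fill_involution (V : nmodType) (T : filling -> filling) (P : pred filling)
    (F : filling -> V) :
  (forall s, super_filling lam N s -> super_filling lam N (T s)) -> involutive T ->
  \sum_(e | P (@fill lam N e)) F (fill e) = \sum_(e | P (T (@fill lam N e))) F (T (fill e)).
Proof.
move=> T_filling TK.
have encode_T (e : encoding) : exists e' : encoding, fill e' = T (fill e).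
  exact/fill_surj/T_filling/fill_super_filling.
have [f fill_f] := fin_all_exists encode_T.
have fK : involutive f by move=> e; apply: fill_inj; rewrite !fill_f TK.
by rewrite (reindex_inj (inv_inj fK)); apply: eq_big => [e|e _]; rewrite fill_f.
Qed.

End Fill.

Section FiberSum.

Variables (R : comNzRingType) (lam : seq nat) (N : nat) (q t : R) (x : nat -> R) (a r : nat).
Hypotheses (lamP : is_partition lam) (lt_ar : (a < r)%N).

(* The weight of [s] without the contribution of its word; the subtraction is
   exact by [coinv_block_word_leq_quinv]. *)
Definition rest_weight (s : filling) : R :=
  (-1) ^+ (nneg lam s + nneg_word (block_word lam a r s)) * q ^+ (npos lam s + maj lam s)
  * t ^+ (quinv lam s - coinv (block_word lam a r s)) * \prod_(u <- cells lam) x (absl (entry s u)).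

Definition fiber_sum (p : seq (option bool)) : R :=
  \sum_(e | admissible lam a r (@fill lam N e) && (block_word lam a r (fill e) == p))
     rest_weight (fill e).

Lemma weight_block_word s : (coinv (block_word lam a r s) <= quinv lam s)%N ->
  weight lam q t x s =
  (-1) ^+ nneg_word (block_word lam a r s) * t ^+ coinv (block_word lam a r s) * rest_weight s.
Proof.
move=> le_coinv; rewrite /weight /rest_weight -{1}(subnKC le_coinv) !exprD.
have := signrMK (nneg_word (block_word lam a r s)) (1 : R); rewrite mulr1.
move: ((-1) ^+ nneg_word _) (_ ^+ nneg _ _) (\prod_(_ <- _) _) => sgn sgn_s monomial sgn2.
by rewrite -[LHS]mul1r -sgn2; ring.
Qed.

Lemma fiber_sum_involution (T : filling -> filling) p p' :
  (forall s, super_filling lam N s -> super_filling lam N (T s)) -> involutive T ->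
  (forall s, admissible lam a r (T s) = admissible lam a r s) ->
  (forall s, (block_word lam a r (T s) == p) = (block_word lam a r s == p')) ->
  (forall s, super_filling lam N s -> admissible lam a r s -> block_word lam a r s = p' ->
     rest_weight (T s) = rest_weight s) ->
  fiber_sum p = fiber_sum p'.
Proof.
move=> T_filling TK T_adm T_word T_weight.
rewrite /fiber_sum (@big_fill_involution lam N R T
  (fun s => admissible lam a r s && (block_word lam a r s == p)) rest_weight) //.
apply: eq_big => [e|e]; rewrite T_adm T_word // => /andP[e_adm /eqP e_word].
by apply: T_weight => //; apply: fill_super_filling.
Qed.

Lemma fiber_sum_size p : size p != size (block lam r) -> fiber_sum p = 0.
Proof.
move=> ne_size; apply: big_pred0 => e; apply/negbTE; apply: contra ne_size => /andP[_ /eqP <-].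
by rewrite size_map.
Qed.

Lemma rest_weight_col_swap u y z v s : let j := (block_start lam r + size u)%N in
  lamc lam j = r -> lamc lam j.+1 = r -> supported lam s -> admissible lam a r s ->
  block_word lam a r s = u ++ z :: y :: v -> isSome y || isSome z ->
  rest_weight (col_swap r j s) = rest_weight s.
Proof.
move=> j lamc_j lamc_jS s_supp s_adm word_s marked_yz.
have r_gt0 : (0 < r)%N by lia.
have j_gt0 : (0 < j)%N by [].
have coinv_s := coinv_block_word_leq_quinv lamP s_supp s_adm lt_ar.
have := quinv_coinv_col_swap lamP r_gt0 word_s s_supp s_adm lt_ar marked_yz.
have nneg_word_swap : nneg_word (u ++ y :: z :: v) = nneg_word (u ++ z :: y :: v).
  by rewrite /nneg_word !count_cat /=; lia.
rewrite /rest_weight (block_word_col_swap lamP r_gt0 word_s) word_s -/j in coinv_s * => quinv_s.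
rewrite maj_col_swap // nneg_word_swap /nneg /npos.
rewrite (count_col_swap lamP j_gt0 lamc_j lamc_jS is_neg).
rewrite (count_col_swap lamP j_gt0 lamc_j lamc_jS (fun b => ~~ is_neg b)).
congr (_ * _ ^+ _ * _); first by lia.
by rewrite -[RHS](perm_big _ (perm_swap_cells lamP j_gt0 lamc_j lamc_jS s)) big_map.
Qed.

Lemma fiber_sum_swap u y z v : fiber_sum (u ++ y :: z :: v) = fiber_sum (u ++ z :: y :: v).
Proof.
have r_gt0 : (0 < r)%N by lia.
have [size_word|ne_size] := eqVneq (size u + (size v).+2)%N (size (block lam r)); last first.
  by rewrite !fiber_sum_size // size_cat.
have [marked_yz|] := boolP (isSome y || isSome z); last by case: y z => [b|] [b'|].
set j := (block_start lam r + size u)%N.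
have lamc_j : lamc lam j = r by apply: lamc_block => //; lia.
have lamc_jS : lamc lam j.+1 = r by rewrite /j -addnS; apply: lamc_block => //; lia.
apply: (@fiber_sum_involution (col_swap r j)) => [s|s|s|s|s [s_supp _] s_adm word_s].
- exact: super_filling_col_swap.
- exact: col_swapK.
- exact: admissible_col_swap.
- apply/eqP/eqP => [word_s|]; last exact: block_word_col_swap.
  by rewrite -(col_swapK r j s); apply: block_word_col_swap.
exact: rest_weight_col_swap word_s marked_yz.
Qed.

Section WordFlip.

Let first := block_start lam r.
Hypothesis first_in : in_dg lam (r, first).

Lemma rest_weight_flip_pos s : supported lam s -> admissible lam a r s -> (0 < a)%N ->
  s r first = (a, false) -> rest_weight (flip_cell (r, first) s) = rest_weight s.
Proof.
move=> s_supp s_adm a_gt0 s_first.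
have coinv_s := coinv_block_word_leq_quinv lamP s_supp s_adm lt_ar.
have quinv_s := quinv_flip_cell lamP s_supp lt_ar s_adm first_in s_first.
have flip_first : flip_cell (r, first) s r first = (a, true) by exact: flip_cell_at.
have nneg_s : (nneg lam (flip_cell (r, first) s) = nneg lam s + 1)%N.
  by have := count_flip_cell s is_neg first_in; rewrite /entry /= flip_first s_first addn0.
have npos_s : (npos lam (flip_cell (r, first) s) + 1 = npos lam s)%N.
  have := count_flip_cell s (fun b => ~~ is_neg b) first_in.
  by rewrite /entry /= flip_first s_first addn0.
have nneg_word_s : nneg_word (block_word lam a r (flip_cell (r, first) s)) =
    (nneg_word (block_word lam a r s)).+1.
  rewrite block_word_flip_cell nneg_word_flip_head // nth0_block_word // -/first s_first.
  by rewrite /letter_mark /absl /= eqxx.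
rewrite /rest_weight nneg_s nneg_word_s -npos_s.
rewrite (maj_flip_cell lamP lt_ar s_adm first_in s_first a_gt0).
congr (_ * _ ^+ _ * _ ^+ _ * _).
- by rewrite addnS addn1 addSn !exprS mulrA mulrNN mulr1 mul1r.
- by lia.
- by rewrite -/first in quinv_s; lia.
by apply: eq_bigr => u _; rewrite absl_flip_cell.
Qed.

Lemma rest_weight_flip_cell s : super_filling lam N s -> admissible lam a r s ->
  absl (s r first) = a -> rest_weight (flip_cell (r, first) s) = rest_weight s.
Proof.
move=> s_filling s_adm abs_first; have [s_supp s_bounded] := s_filling.
have first_cell : (r, first) \in cells lam by rewrite mem_cells.
have a_gt0 : (0 < a)%N by rewrite -abs_first; have /andP[] := s_bounded _ first_cell.
case s_first: (s r first) abs_first => [a' []] /= eq_a;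
  rewrite /absl /= in eq_a; rewrite eq_a in s_first.
  rewrite -[in RHS](flip_cellK (r, first) s); symmetry; apply: rest_weight_flip_pos => //.
  - exact: supported_flip_cell.
  - by rewrite admissible_flip_cell.
  by rewrite /flip_cell eqxx s_first.
exact: rest_weight_flip_pos.
Qed.

End WordFlip.

Lemma fiber_sum_flip_head p : fiber_sum (flip_head p) = fiber_sum p.
Proof.
case: p => [//|[b|//] w].
have [eq_size|ne_size] := eqVneq (size w).+1 (size (block lam r)); last first.
  by rewrite !fiber_sum_size.
have first_in : in_dg lam (r, block_start lam r).
  by rewrite in_dg_block_start -?eq_size //; lia.
apply: (@fiber_sum_involution (flip_cell (r, block_start lam r))) => [s|s|s|s|s s_filling].
- exact: super_filling_flip_cell.
- exact: flip_cellK.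
- exact: admissible_flip_cell.
- by rewrite block_word_flip_cell (inj_eq (inv_inj flip_headK)).
move=> s_adm word_s; apply: rest_weight_flip_cell => //.
have := nth0_block_word a s lamP first_in.
by rewrite word_s /letter_mark; case: eqP.
Qed.

Lemma sum_weight_block_word m :
  \sum_(e | admissible lam a r (@fill lam N e) && (nmarked (block_word lam a r (fill e)) == m))
    weight lam q t x (fill e) =
  \sum_(p : (size (block lam r)).-tuple (option bool) | nmarked p == m)
    (-1) ^+ nneg_word p * t ^+ coinv p * fiber_sum p.
Proof.
pose word e := map_tuple (fun i => letter_mark a (@fill lam N e r i)) (in_tuple (block lam r)).
rewrite (partition_big word (fun p => nmarked p == m)) /= => [|e /andP[] //].
apply: eq_bigr => p nmarked_p; rewrite /fiber_sum mulr_sumr.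
apply: eq_big => [e|e /andP[/andP[e_adm _] /eqP <-]].
  rewrite -val_eqE /= -andbA -/(block_word lam a r (fill e)).
  by have [->|_] := eqVneq (block_word _ _ _ _) (val p); rewrite ?nmarked_p ?andbF.
have [e_supp _] := fill_super_filling e.
by rewrite -weight_block_word //; apply: coinv_block_word_leq_quinv.
Qed.

Lemma admissible_sum_eq0 m : (0 < m)%N ->
  \sum_(e | admissible lam a r (@fill lam N e) && (nmarked (block_word lam a r (fill e)) == m))
    weight lam q t x (fill e) = 0.
Proof.
move=> m_gt0; rewrite sum_weight_block_word; set n := size _.
transitivity (signed_word_sum t n m 1 *
    fiber_sum (nseq m (Some false) ++ nseq (n - m) None)); last first.
  by rewrite signed_word_sum1 // mul0r.
rewrite /signed_word_sum mulr_suml; apply: eq_bigr => p /eqP nmarked_p; congr (_ * _).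
have le_mn : (m <= n)%N by rewrite -nmarked_p -[leqRHS](size_tuple p); apply: count_size.
apply: (word_invariant fiber_sum_swap fiber_sum_flip_head).
  by rewrite size_tuple size_cat !size_nseq subnKC.
by rewrite nmarked_p /nmarked count_cat !count_nseq /= mul1n addn0.
Qed.

End FiberSum.

Theorem mainTheorem12 (R : comNzRingType) (lam : seq nat) :
  is_partition lam ->
  forall (N : nat) (q t : R) (x : nat -> R),
    \sum_(e : (size (cells lam)).-tuple ('I_N * bool)
            | phi_degenerate lam (@fill lam N e))
       weight lam q t x (@fill lam N e) = 0.
Proof.
move=> lamP N q t x.
apply: (sum_fibers_eq0 (key := fun e => dist_key lam (fill e))) => -[[a r]|]; last first.
  apply: big_pred0 => e; rewrite /phi_degenerate /dist_key.
  by case: dlabel => // a; case: dcell => [w|] //; rewrite andbF.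
under eq_bigl do rewrite (phi_degenerate_dist_key _ lamP (fill_super_filling _)).
have [lt_ar|_] := ltnP a r; last by rewrite big_pred0.
apply: (sum_fibers_eq0 (key := fun e => nmarked (block_word lam a r (fill e)))) => m.
case: m => [|m].
  by apply: big_pred0 => e; case: (nmarked _) => [|k]; rewrite !andbF.
have [size_gt1|_] := ltnP 1 (size (block lam r)); last by rewrite big_pred0.
rewrite -[RHS](admissible_sum_eq0 N q t x lamP lt_ar (ltn0Sn m)); apply: eq_bigl => e /=.
by rewrite -andbA; case: eqP => [->|]; rewrite ?andbF.
Qed.
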